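(* i) Let $\mathfrak{h}$ be a finite-dimensional real Lie algebra and $T^*\mathfrak{h}$ its cotangent Lie algebra. If $T^*\mathfrak{h}$ admits a lagrangian symplectic structure, then $\mathfrak{h}$ is nilpotent. ii) The tangent Lie algebra $T\mathfrak{h}$ admits a lagrangian symplectic structure for any $\mathfrak{h}$ isomorphic to $\mathfrak{h}_1$, $\mathfrak{r}_{3,-1}$, $\mathfrak{r}_{3,0}'$ or $\mathbb{R}\times\mathfrak{aff}(\mathbb{R})$.
   Context: For a representation $\pi$ of $\mathfrak{h}$ on $V$ with $\dim V=\dim\mathfrak{h}$, $T_\pi\mathfrak{h}=\mathfrak{h}\ltimes_\pi V$ is $\mathfrak{h}\oplus V$ with bracket $[(x,v),(x',v')]=([x,x'],\pi(x)v'-\pi(x')v)$. The tangent Lie algebra $T\mathfrak{h}$ is the case $\pi=\mathrm{ad}$, $V=\mathfrak{h}$; the cotangent Lie algebra $T^*\mathfrak{h}$ is the case $V=\mathfrak{h}^*$, $\pi=\mathrm{ad}^*$, $(\mathrm{ad}^*(x)\varphi)(y)=-\varphi([x,y])$. A symplectic structure on $\mathfrak{g}$ is a non-degenerate 2-form $\omega$ with $\omega([x,y],z)+\omega([y,z],x)+\omega([z,x],y)=0$ for all $x,y,z\in\mathfrak{g}$. A symplectic structure on $T_\pi\mathfrak{h}=\mathfrak{h}\ltimes_\pi V$ is called lagrangian if both $\mathfrak{h}$ and $V$ are lagrangian subspaces for $\omega$. The three-dimensional Lie algebras have basis $e_1,e_2,e_3$ and non-zero brackets: $\mathfrak{h}_1$: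 $[e_1,e_2]=e_3$; $\mathfrak{r}_{3,-1}$: $[e_1,e_2]=e_2$, $[e_1,e_3]=-e_3$; $\mathfrak{r}_{3,0}'$: $[e_1,e_2]=-e_3$, $[e_1,e_3]=e_2$; $\mathbb{R}\times\mathfrak{aff}(\mathbb{R})$: $[e_1,e_2]=e_2$. *)

(* Defs.v *)
From HB Require Import structures.
From mathcomp Require Import all_boot all_algebra sesquilinear reals ring.

Set Implicit Arguments.
Unset Strict Implicit.
Unset Printing Implicit Defensive.

Import GRing.Theory.
Local Open Scope ring_scope.

HB.mixin Record Vector_isLieAlgebra (R : nzRingType) (V : Type)
    of Vector R V := {
  lie : V -> V -> V;
  lie_bilinear_subproof : bilinear_for *:%R *:%R lie;
  liexx : forall x, lie x x = 0;
  lie_jacobi : forall x y z,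
    lie x (lie y z) + lie y (lie z x) + lie z (lie x y) = 0
}.

#[short(type="lieAlgType")]
HB.structure Definition LieAlgebra (R : nzRingType) :=
  { V of Vector_isLieAlgebra R V & Vector R V }.

Section LieTheory.
Variables (R : fieldType) (h : lieAlgType R).
Implicit Types (x y z : h) (U W : {vspace h}).

HB.instance Definition _ := bilinear_isBilinear.Build R h h h *:%R *:%R
  (@lie R h) (@lie_bilinear_subproof R h).

HB.instance Definition _ x := GRing.isLinear.Build R h h *:%R (lie x)
  (linearPr (@lie R h) x).

Lemma lie_anti x y : lie x y = - lie y x.
Proof.
apply/eqP; rewrite -addr_eq0; apply/eqP.
by have := liexx (x + y); rewrite linearDr linearDl /= linearDl /=
   !liexx add0r addr0 addrC.
Qed.

Definition lie_prodv U W : {vspace h} :=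
  <<[seq lie x y | x <- vbasis U, y <- vbasis W]>>%VS.

Lemma mem_lie_prodv U W x y : x \in U -> y \in W -> lie x y \in lie_prodv U W.
Proof.
move=> /coord_vbasis-> /coord_vbasis->.
rewrite linear_sumr memv_suml// => j _; rewrite linear_sumlz memv_suml// => i _.
rewrite linearZl_LR linearZr_LR /= !memvZ// memv_span//.
by apply: allpairs_f; rewrite mem_nth// size_tuple.
Qed.

Fixpoint lower_central (n : nat) : {vspace h} :=
  if n is m.+1 then lie_prodv fullv (lower_central m) else fullv.

Definition lie_nilpotent : Prop := exists n, lower_central n = 0%VS.

End LieTheory.

Definition lie_isomorphic (R : fieldType) (g h : lieAlgType R) : Prop :=
  exists2 f : {linear g -> h}, bijective f &
    forall x y, f (lie x y) = lie (f x) (f y).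

Record lieRep (R : fieldType) (h : lieAlgType R) (V : vectType R) := LieRep {
  rep_map :> {linear h -> 'End(V)};
  rep_lie : forall x y v,
    rep_map (lie x y) v = rep_map x (rep_map y v) - rep_map y (rep_map x v)
}.

(* The carrier of T_pi h.  The usual requirement dim V = dim h plays no role in
   the construction, and holds for both V = h and V = h^*. *)
Definition semidirect (R : fieldType) (h : lieAlgType R) (V : vectType R)
  (pi : lieRep h V) : Type := (h * V)%type.

Section Semidirect.
Variables (R : fieldType) (h : lieAlgType R) (V : vectType R).
Variable pi : lieRep h V.

HB.instance Definition _ := Vector.copy (semidirect pi) (h * V)%type.

Definition semidirect_lie (p q : semidirect pi) : semidirect pi :=
  (lie p.1 q.1, pi p.1 q.2 - pi q.1 p.2).

Lemma rep_mapP a x y v : pi (a *: x + y) v = a *: pi x v + pi y v.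
Proof. by rewrite linearP lfunE /= lfunE. Qed.

Fact semidirect_lie_bilinear : bilinear_for *:%R *:%R semidirect_lie.
Proof.
split=> [q a p p'|p a q q']; congr (_, _) => /=.
- exact: (linearPl (@lie R h)).
- by rewrite rep_mapP linearP opprD addrACA scalerBr.
- exact: (linearPr (@lie R h)).
- by rewrite rep_mapP linearP opprD addrACA scalerBr.
Qed.

Fact semidirect_liexx p : semidirect_lie p p = 0.
Proof. by rewrite /semidirect_lie liexx subrr. Qed.

Fact semidirect_lie_jacobi p q r :
  semidirect_lie p (semidirect_lie q r) + semidirect_lie q (semidirect_lie r p)
    + semidirect_lie r (semidirect_lie p q) = 0.
Proof.
congr (_, _) => /=; first exact: lie_jacobi.
rewrite !rep_lie !linearB /=.
set a := pi p.1 (pi q.1 r.2); set b := pi p.1 (pi r.1 q.2).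
set c := pi q.1 (pi r.1 p.2); set d := pi q.1 (pi p.1 r.2).
set e := pi r.1 (pi p.1 q.2); set f := pi r.1 (pi q.1 p.2).
rewrite !opprK (addrC (- c)) (addrC (- e)) (addrC (- a)).
by rewrite (addrC (c - d)) (addrACA (a - b)) !subrKA addrACA !subrKA subrr.
Qed.

HB.instance Definition _ := Vector_isLieAlgebra.Build R (semidirect pi)
  semidirect_lie_bilinear semidirect_liexx semidirect_lie_jacobi.

Definition semidirect_inl (x : h) : semidirect pi := (x, 0).
Definition semidirect_inr (v : V) : semidirect pi := (0, v).

Fact semidirect_inl_linear : linear semidirect_inl.
Proof. by move=> a x y; congr (_, _); rewrite /= scaler0 addr0. Qed.

Fact semidirect_inr_linear : linear semidirect_inr.
Proof. by move=> a x y; congr (_, _); rewrite /= scaler0 addr0. Qed.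

HB.instance Definition _ :=
  GRing.isLinear.Build R h (semidirect pi) _ _ semidirect_inl_linear.
HB.instance Definition _ :=
  GRing.isLinear.Build R V (semidirect pi) _ _ semidirect_inr_linear.

Definition base_subspace : {vspace semidirect pi} :=
  limg (linfun semidirect_inl).
Definition fibre_subspace : {vspace semidirect pi} :=
  limg (linfun semidirect_inr).

Lemma mem_base_subspace p : (p \in base_subspace) = (p.2 == 0).
Proof.
apply/memv_imgP/eqP => [[x _ ->]|p0]; first by rewrite lfunE.
by exists p.1; rewrite ?memvf// lfunE /= /semidirect_inl -p0 -surjective_pairing.
Qed.

Lemma mem_fibre_subspace p : (p \in fibre_subspace) = (p.1 == 0).
Proof.
apply/memv_imgP/eqP => [[x _ ->]|p0]; first by rewrite lfunE.
by exists p.2; rewrite ?memvf// lfunE /= /semidirect_inr -p0 -surjective_pairing.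
Qed.

End Semidirect.

Section AdjointCoadjoint.
Variables (R : fieldType) (h : lieAlgType R).

Definition ad (x : h) : 'End(h) := linfun (lie x).

Lemma adE x y : ad x y = lie x y.
Proof. by rewrite /ad lfunE. Qed.

Fact ad_linear : linear ad.
Proof.
move=> a x y; apply/lfunP=> z; rewrite !lfunE /= scale_lfunE !adE.
exact: (linearPl (@lie R h)).
Qed.

HB.instance Definition _ := GRing.isLinear.Build R h 'End(h) _ ad ad_linear.

Fact ad_lie x y z : ad (lie x y) z = ad x (ad y z) - ad y (ad x z).
Proof.
rewrite !adE; have := lie_jacobi x y z.
rewrite (lie_anti z x) (lie_anti z (lie x y)) linearNr.
by move/eqP; rewrite subr_eq0 => /eqP.
Qed.

Definition ad_rep : lieRep h h := LieRep ad_lie.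

(* The dual h^* is represented by 'Hom(h, R^o). *)
Definition coad_fun (x : h) (phi : 'Hom(h, R^o)) : 'Hom(h, R^o) :=
  - (phi \o ad x)%VF.

Lemma coad_funE x phi y : coad_fun x phi y = - phi (lie x y).
Proof. by rewrite opp_lfunE comp_lfunE adE. Qed.

Fact coad_fun_linear x : linear (coad_fun x).
Proof.
move=> a phi psi; apply/lfunP=> y.
by rewrite coad_funE !lfunE /= !scale_lfunE !coad_funE opprD scalerN.
Qed.

HB.instance Definition _ x :=
  GRing.isLinear.Build R 'Hom(h, R^o) 'Hom(h, R^o) _ _ (coad_fun_linear x).

Definition coad (x : h) : 'End('Hom(h, R^o)) := linfun (coad_fun x).

Lemma coadE x phi y : coad x phi y = - phi (lie x y).
Proof. by rewrite /coad lfunE coad_funE. Qed.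

Fact coad_linear : linear coad.
Proof.
move=> a x y; apply/lfunP=> phi; apply/lfunP=> z.
rewrite coadE lfunE /= lfunE /= lfunE /= lfunE /= !coadE.
by rewrite (linearPl (@lie R h)) linearP opprD scalerN.
Qed.

HB.instance Definition _ :=
  GRing.isLinear.Build R h 'End('Hom(h, R^o)) _ coad coad_linear.

Fact coad_lie x y phi :
  coad (lie x y) phi = coad x (coad y phi) - coad y (coad x phi).
Proof.
apply/lfunP=> z; rewrite add_lfunE opp_lfunE !coadE !opprK.
by have := ad_lie x y z; rewrite !adE => ->; rewrite linearB opprB.
Qed.

Definition coad_rep : lieRep h 'Hom(h, R^o) := LieRep coad_lie.

Definition tangent : lieAlgType R := semidirect ad_rep.
Definition cotangent : lieAlgType R := semidirect coad_rep.

End AdjointCoadjoint.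

Section Symplectic.
Variable R : realType.

(* 2-forms are skew-symmetric bilinear forms. *)
Definition closed_form (g : lieAlgType R) (omega : {skew_symmetric g}) : Prop :=
  forall x y z,
    omega (lie x y) z + omega (lie y z) x + omega (lie z x) y = 0.

Definition symplectic (g : lieAlgType R) (omega : {skew_symmetric g}) : Prop :=
  nondegenerate omega /\ closed_form omega.

Definition lagrangian (g : lieAlgType R) (omega : {skew_symmetric g})
    (W : {vspace g}) : Prop :=
  orthov omega W = W.

Definition lagrangian_symplectic (h : lieAlgType R) (V : vectType R)
    (pi : lieRep h V) (omega : {skew_symmetric (semidirect pi)}) : Prop :=
  [/\ symplectic omega, lagrangian omega (base_subspace pi)
    & lagrangian omega (fibre_subspace pi)].

End Symplectic.

(* The carrier of the algebra with basis e_1, e_2, e_3 and brackets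
   [e_1, e_2] = a e_2 + b e_3, [e_1, e_3] = c e_2 + d e_3, [e_2, e_3] = 0. *)
Definition lie3 (R : fieldType) (a b c d : R) : Type := 'rV[R]_3.

Section Lie3.
Variables (R : fieldType) (a b c d : R).
Local Notation L := (lie3 a b c d).

HB.instance Definition _ := Vector.copy L 'rV[R]_3.

Definition lie3_e (i : 'I_3) : L := delta_mx 0 i.
Let e1 : L := lie3_e 0.
Let e2 : L := lie3_e 1.
Let e3 : L := lie3_e 2.

Definition lie3_lie (u v : L) : L :=
  (u 0 0 * v 0 1 - u 0 1 * v 0 0) *: (a *: e2 + b *: e3) +
  (u 0 0 * v 0 2 - u 0 2 * v 0 0) *: (c *: e2 + d *: e3).

Fact lie3_lie_bilinear : bilinear_for *:%R *:%R lie3_lie.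
Proof.
split=> [v k u u'|u k v v']; apply/rowP=> i; rewrite !mxE; ring.
Qed.

Fact lie3_liexx u : lie3_lie u u = 0.
Proof. apply/rowP=> i; rewrite !mxE; ring. Qed.

Fact lie3_lie_jacobi u v w :
  lie3_lie u (lie3_lie v w) + lie3_lie v (lie3_lie w u)
    + lie3_lie w (lie3_lie u v) = 0.
Proof. apply/rowP=> i; rewrite !mxE /=; ring. Qed.

HB.instance Definition _ := Vector_isLieAlgebra.Build R L
  lie3_lie_bilinear lie3_liexx lie3_lie_jacobi.

Lemma lie3_e12 : lie e1 e2 = a *: e2 + b *: e3.
Proof. apply/rowP=> i; rewrite !mxE /=; ring. Qed.

Lemma lie3_e13 : lie e1 e3 = c *: e2 + d *: e3.
Proof. apply/rowP=> i; rewrite !mxE /=; ring. Qed.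

Lemma lie3_e23 : lie e2 e3 = 0.
Proof. apply/rowP=> i; rewrite !mxE /=; ring. Qed.

End Lie3.

Definition heisenberg3 (R : fieldType) : lieAlgType R :=
  lie3 (0 : R) 1 0 0.
Definition r3_m1 (R : fieldType) : lieAlgType R :=
  lie3 (1 : R) 0 0 (-1).
Definition r3_0' (R : fieldType) : lieAlgType R :=
  lie3 (0 : R) (-1) 1 0.
Definition R_aff (R : fieldType) : lieAlgType R :=
  lie3 (1 : R) 0 0 0.

(* Main.v *)
Require Import Defs.
From HB Require Import structures.
From mathcomp Require Import all_boot all_algebra sesquilinear reals.
From mathcomp Require Import boolp ring complex.

(* (i) A lagrangian symplectic form on T^*h pairs h with h^*, which amounts to an
   invertible map D : h -> h, and closedness says precisely that D is a
   derivation.  A Lie algebra with a nonsingular derivation is nilpotent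
   (Jacobson): after extending scalars to the complex numbers, ad u is nilpotent
   for every generalized eigenvector u of D, these operators are closed under
   commutators and span ad(h), so the Engel-Jacobson theorem on weakly closed
   sets of nilpotent operators applies.
   (ii) omega((x, v), (x', v')) = B(x, v') - B(x', v) is a lagrangian symplectic
   form on Th as soon as B is a nondegenerate bilinear form, not necessarily
   symmetric, with B([x, y], z) = B(x, [y, z]) - B(y, [x, z]); such a B is
   exhibited in each case. *)

Set Implicit Arguments.
Unset Strict Implicit.
Unset Printing Implicit Defensive.

Import GRing.Theory Num.Theory VectorInternalTheory.
Local Open Scope ring_scope.

(** * The Engel-Jacobson theorem *)

Section EngelJacobson.
Variables (F : fieldType) (n : nat).
Implicit Types (U : {vspace 'M[F]_n}) (v : 'rV[F]_n) (b t : 'M[F]_n).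

(** Layer [k] of an ascending filtration: the vectors killed by every product of [k] elements of
    [U]. If some layer is the whole space, [U] is jointly nilpotent. *)
Fixpoint annihilated U k v : Prop :=
  if k is k'.+1 then forall t, t \in U -> annihilated U k' (v *m t) else v = 0.

Lemma annihilatedP U k a v w :
  annihilated U k v -> annihilated U k w -> annihilated U k (a *: v + w).
Proof.
elim: k v w => [|k IH] v w /=; first by move=> -> ->; rewrite scaler0 addr0.
by move=> hv hw t tU; rewrite mulmxDl -scalemxAl; apply: IH; auto.
Qed.

Lemma annihilated0 U k : annihilated U k 0.
Proof. by elim: k => //= k IH t _; rewrite mul0mx. Qed.

Lemma annihilatedZ U k a v : annihilated U k v -> annihilated U k (a *: v).
Proof. by rewrite -[_ *: _]addr0 => /annihilatedP; apply; apply: annihilated0. Qed.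

Lemma annihilatedD U k v w :
  annihilated U k v -> annihilated U k w -> annihilated U k (v + w).
Proof. by rewrite -{2}[v]scale1r; apply: annihilatedP. Qed.

Lemma annihilatedB U k v w :
  annihilated U k v -> annihilated U k w -> annihilated U k (v - w).
Proof. by rewrite addrC -scaleN1r => hv hw; apply: annihilatedP. Qed.

Lemma annihilatedS U k v : annihilated U k v -> annihilated U k.+1 v.
Proof.
elim: k v => [v -> t _|k IH v hv t tU]; first exact: mul0mx.
exact: IH (hv t tU).
Qed.

(** [v *m b *m t] is [v *m t *m b] minus [v] times a commutator in [U]; both terms lie one layer
    lower. *)
Lemma annihilated_normalizer U b : (forall t, t \in U -> t *m b - b *m t \in U) ->
  forall k v, annihilated U k v -> annihilated U k (v *m b).
Proof.
move=> bU; elim=> [|k IH] v /= hv; first by rewrite hv mul0mx.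
move=> t tU; rewrite -mulmxA.
have -> : b *m t = t *m b - (t *m b - b *m t) by rewrite subKr.
rewrite mulmxBr mulmxA; apply: annihilatedB; first exact/IH/hv.
exact/hv/bU.
Qed.

(* [b] preserves each layer [annihilated U k]; modulo layer [k] every element of
   [U + <[b]>] acts on layer [k.+1] as a multiple of [b], so [m] factors suffice
   to descend one layer. *)
Lemma annihilated_adjoin U b m :
  (forall t, t \in U -> t *m b - b *m t \in U) -> b ^+ m = 0 ->
  forall k v, annihilated U k v -> annihilated (U + <[b]>) (k * m) v.
Proof.
move=> bU bm0; elim=> // k IH.
(* Once [v *m b ^+ j] is in layer [k], any [j] further factors bring [v] itself into layer [k]. *)
have step j v : annihilated U k.+1 v -> annihilated U k (v *m b ^+ j) ->
    annihilated (U + <[b]>) (k * m + j) v.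
  elim: j v => [|j IHj] v hv hvb.
    by rewrite addn0; apply: IH; rewrite expr0 mulmx1 in hvb.
  rewrite addnS /= => _ /memv_addP[t tU [_ /vlineP[a ->] ->]].
  have hvt : annihilated U k (v *m t) by apply: hv.
  apply: IHj.
    rewrite mulmxDr -scalemxAr; apply: annihilatedD; first exact: annihilatedS.
    exact/annihilatedZ/annihilated_normalizer.
  rewrite mulmxDr mulmxDl; apply: annihilatedD.
    elim: (j) => [|i IHi]; first by rewrite expr0 mulmx1.
    rewrite exprSr mulmxA; exact: annihilated_normalizer.
  by rewrite -scalemxAr -scalemxAl -mulmxA -[b *m _]exprS; apply: annihilatedZ.
move=> v hv; rewrite mulSn addnC; apply: step => //.
by rewrite bm0 mulmx0; apply: annihilated0.
Qed.

Section Shift.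
Variables (U : {vspace 'M[F]_n}) (N : nat).
Hypothesis annU : forall v, annihilated U N v.

(** Subtraction is truncated. [shift 0] always holds, since layer [N] is everything. *)
Let shift d (c : 'M[F]_n) := forall k v, annihilated U k v ->
  annihilated U (k + N - d) (v *m c).

(* Each commutation with [U] raises [d] in [shift d] by one, and the only
   matrix with [shift (N + N)] is [0]; so repeatedly replacing [c] by a commutator lying outside
   [U] must stop, at a matrix that normalizes [U]. *)
Lemma normalizer_step (S : 'M[F]_n -> Prop) (X : seq 'M[F]_n) :
    (forall s t, S s -> S t -> S (s *m t - t *m s)) ->
    {in X, forall t, S t} -> U = <<X>>%VS ->
  forall c, S c -> c \notin U ->
  exists b, [/\ S b, b \notin U & forall t, t \in U -> t *m b - b *m t \in U].
Proof.
move=> Sclosed XS UX.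
have annE k v : (N <= k)%N -> annihilated U k v.
  by move/subnK <-; elim: (k - N)%N => // i IH; rewrite addSn; exact: annihilatedS.
suff loop e d c : (d + e = N + N)%N -> shift d c -> S c -> c \notin U ->
    exists b, [/\ S b, b \notin U & forall t, t \in U -> t *m b - b *m t \in U].
  move=> c; apply: (loop (N + N)%N 0) => // k v _.
  by rewrite subn0; apply: annE; rewrite leq_addl.
elim: e d c => [|e IH] d c de shc Sc cU.
  (* Here [d = N + N], so [c] sends layer [N], the whole space, into layer [0]. *)
  case/negP: cU; suff -> : c = 0 by rewrite mem0v.
  apply/row_matrixP => i; rewrite rowE row0.
  by have := shc N _ (annU (delta_mx 0 i)); rewrite -de addn0 subnn.
have [[t tX tcU]|noX] := pselect (exists2 t, t \in X & t *m c - c *m t \notin U).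
  apply: (IH d.+1 (t *m c - c *m t)) => //; first by rewrite addSnnS.
    move=> k v hv; rewrite mulmxBr !mulmxA.
    have tU : t \in U by rewrite UX memv_span.
    (* In either product [t] lowers the layer by one, before or after [c]; layer [0] is treated
       apart. *)
    apply: annihilatedB.
      case: k hv => [->|k hv]; first by rewrite !mul0mx; apply: annihilated0.
      by rewrite addSn subSS; apply/shc/hv.
    rewrite subnS; have := shc k v hv; case: (k + N - d)%N => [/= ->|i /=].
      by rewrite mul0mx.
    exact.
  by apply: Sclosed => //; apply: XS.
exists c; split=> // t; rewrite {1}UX => tX.
have {tX} /coord_span-> : t \in <<in_tuple X>>%VS by [].
rewrite mulmx_suml mulmx_sumr -sumrB memv_suml // => i _.
rewrite -scalemxAl -scalemxAr -scalerBr memvZ //.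
apply: contrapT => /negP XcU; apply: noX.
by exists X`_i => //; rewrite mem_nth.
Qed.

End Shift.

(** A jointly nilpotent span of elements of [S], closed under commutators, is enlarged by an element
    of [S] normalizing it until it contains [S]. The counter [d] bounds its codimension. *)
Lemma engel_jacobson (S : 'M[F]_n -> Prop) :
    (forall s t, S s -> S t -> S (s *m t - t *m s)) ->
    (forall s, S s -> exists m, s ^+ m = 0) ->
  exists (U : {vspace 'M[F]_n}) N,
    (forall s, S s -> s \in U) /\ forall v, annihilated U N v.
Proof.
move=> Sclosed Snil.
suff loop d (X : seq 'M[F]_n) N : (\dim {:'M[F]_n} <= \dim <<X>> + d)%N ->
    {in X, forall t, S t} -> {in X & X, forall s t, s *m t - t *m s \in <<X>>%VS} ->
    (forall v, annihilated <<X>> N v) ->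
  exists (U : {vspace 'M[F]_n}) N,
    (forall s, S s -> s \in U) /\ forall v, annihilated U N v.
  apply: (loop (\dim {:'M[F]_n}) [::] 1%N) => // [|v t]; first exact: leq_addl.
  by rewrite span_nil memv0 => /eqP ->; rewrite mulmx0.
elim: d X N => [|d IH] X N dimX XS Xcl annX.
  exists <<X>>%VS, N; split=> // s _; have := memvf s.
  suff -> : fullv = <<X>>%VS by [].
  by apply/eqP; rewrite eq_sym eqEdim subvf -[X in (_ <= X)%N]addn0.
have [[c [Sc cX]]|noc] := pselect (exists c, S c /\ c \notin <<X>>%VS); last first.
  exists <<X>>%VS, N; split=> // s Ss; apply: contrapT => /negP sX.
  by apply: noc; exists s.
have [b [Sb bX bU]] := normalizer_step annX Sclosed XS erefl Sc cX.
have [m bm] := Snil _ Sb.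
have eqU : (<<b :: X>> = <<X>> + <[b]>)%VS by rewrite span_cons addvC.
have subX : (<<X>> <= <<b :: X>>)%VS by rewrite eqU addvSl.
apply: (IH (b :: X) (N * m)%N).
- apply: leq_trans dimX _; rewrite addnS -addSn leq_add2r.
  rewrite ltn_neqAle dimvS // andbT; apply/negP => /eqP dimE.
  have /eqP eX : <<X>>%VS == <<b :: X>>%VS by rewrite eqEdim subX dimE leqnn.
  by case/negP: bX; rewrite eX memv_span // mem_head.
- by move=> t; rewrite inE => /predU1P[->|/XS].
- move=> s t; rewrite !inE => /predU1P[->|sX] /predU1P[->|tX].
  + by rewrite subrr mem0v.
  + by rewrite -opprB memvN; apply/(subvP subX)/bU/memv_span.
  + exact/(subvP subX)/bU/memv_span.
  + exact/(subvP subX)/Xcl.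
- move=> v; rewrite eqU; exact: annihilated_adjoin.
Qed.

End EngelJacobson.

(** * Nonsingular derivations *)

Section GeneralizedEigenvectors.
Variable F : closedFieldType.

Definition generalized_eigenvector n (D : 'M[F]_n) a (u : 'rV[F]_n) :=
  exists k, u *m (D - a%:M) ^+ k = 0.

(** By Cayley-Hamilton the kernel of [char_poly D] at [D] is everything, and it is the sum of the
    kernels of the coprime powers of [D - a%:M]. *)
Lemma generalized_eigenvectors_span n (D : 'M[F]_n) (W : {vspace 'rV[F]_n}) :
  (forall a u, generalized_eigenvector D a u -> u \in W) -> W = fullv.
Proof.
move=> genW; apply/vspaceP => v; rewrite memvf.
case: n => [|m] in D v W genW *; first by rewrite thinmx0 mem0v.
have [r rE] := closed_field_poly_normal (char_poly D).
have /eqP lc : lead_coef (char_poly D) == 1 by exact: char_poly_monic.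
rewrite lc scale1r -prodr_undup_exp_count (big_nth 0) big_mkord in rE.
have coprime_r : {in predT &, forall i j : 'I_(size (undup r)), j != i ->
    coprimep (('X - ((undup r)`_i)%:P) ^+ count_mem (undup r)`_i r)
             (('X - ((undup r)`_j)%:P) ^+ count_mem (undup r)`_j r)}.
  move=> i j _ _ ji; rewrite coprimep_expl // coprimep_expr //.
  by rewrite coprimep_XsubC root_XsubC nth_uniq ?undup_uniq.
have : (v <= kermxpoly D (char_poly D))%MS.
  by rewrite (kermxpoly_min (mxminpoly_dvd_char D)) submx1.
rewrite rE (kermxpoly_prod D coprime_r) => /sub_sumsmxP[w ->].
apply: memv_suml => i _; apply: (genW (undup r)`_i).
exists (count_mem (undup r)`_i r).
have -> : (D - ((undup r)`_i)%:M) ^+ count_mem (undup r)`_i r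
    = horner_mx D (('X - ((undup r)`_i)%:P) ^+ count_mem (undup r)`_i r).
  by rewrite rmorphXn rmorphB /= horner_mx_X horner_mx_C.
by rewrite -mulmxA /kermxpoly mulmx_ker mulmx0.
Qed.

(** The last nonzero vector among the [u *m (D - a%:M) ^+ i] is an eigenvector. *)
Lemma generalized_eigenvalue n (D : 'M[F]_n) a u :
  generalized_eigenvector D a u -> u != 0 -> root (char_poly D) a.
Proof.
case=> k; elim: k u => [|k IH] u; first by rewrite expr0 mulmx1 => ->; rewrite eqxx.
rewrite exprS mulmxA => uk u0.
have [uD|] := eqVneq (u *m (D - a%:M)) 0; last exact: IH.
rewrite -eigenvalue_root_char; apply/eigenvalueP; exists u => //.
by apply/eqP; rewrite -subr_eq0 -mul_mx_scalar -mulmxBr uD.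
Qed.

End GeneralizedEigenvectors.

Section NonsingularDerivation.
Variables (F : closedFieldType) (n : nat) (D : 'M[F]_n).
(** With row vectors, [v *m ad u] stands for the bracket of [u] and [v]; [derD] is then the Leibniz
    rule and [adP] the Jacobi identity. *)
Variable ad : {linear 'rV[F]_n -> 'M[F]_n}.
Hypothesis char0 : [pchar F] =i pred0.
Hypothesis Dinj : forall u : 'rV[F]_n, u *m D = 0 -> u = 0.
Hypothesis derD : forall u, ad u *m D = D *m ad u + ad (u *m D).
Hypothesis adP : forall u v, ad v *m ad u - ad u *m ad v = ad (v *m ad u).

(** [D - (b + a)%:M] acts on the bracket by a Leibniz rule, through [D - a%:M] on [u] and [D - b%:M]
    on [v]; after [i + j] applications every term vanishes. *)
Lemma generalized_eigenvector_ad a b u v :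
  generalized_eigenvector D a u -> generalized_eigenvector D b v ->
  generalized_eigenvector D (b + a) (v *m ad u).
Proof.
move=> [i ui] [j vj]; exists (i + j)%N.
have step w z : w *m ad z *m (D - (b + a)%:M) =
    (w *m (D - b%:M)) *m ad z + w *m ad (z *m (D - a%:M)).
  have -> : ad (z *m (D - a%:M)) = ad (z *m D) - a *: ad z.
    by rewrite mulmxBr mul_mx_scalar linearB linearZ.
  rewrite [w *m ad z *m _]mulmxBr -(mulmxA w _ D) derD mulmxDr.
  rewrite !mulmxBr !mul_mx_scalar.
  by rewrite mulmxBl -scalemxAl -scalemxAr scalerDl opprD mulmxA addrACA.
have [m] := ubnP (i + j); elim: m => // m IH in i j u v ui vj *.
rewrite ltnS => ijm.
case: i ui ijm => [|i] ui ijm.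
  by rewrite expr0 mulmx1 in ui; rewrite ui linear0 mulmx0 mul0mx.
case: j vj ijm => [|j] vj ijm.
  by rewrite expr0 mulmx1 in vj; rewrite vj !mul0mx.
rewrite addSn exprS [_ *m (_ *m _)]mulmxA step mulmxDl.
rewrite -{1}addSnnS !IH ?addr0 //.
- by rewrite -mulmxA -[_ *m _ ^+ i]exprS.
- by rewrite -mulmxA -[_ *m _ ^+ j]exprS.
- by rewrite addnS in ijm.
Qed.

(* [ad u] shifts generalized eigenvalues by [a != 0], hence cannot be iterated
   more than [n] times without leaving the spectrum. *)
Lemma ad_generalized_eigenvector_nilpotent a u :
  generalized_eigenvector D a u -> exists m, ad u ^+ m = 0.
Proof.
have [->|u0] := eqVneq u 0; first by exists 1%N; rewrite linear0 expr1.
move=> ua.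
have a0 : a != 0.
  apply: contraNneq u0 => a0; case: ua => k; rewrite a0 raddf0 subr0.
  elim: k => [|k IH]; first by rewrite expr0 mulmx1 => ->.
  by rewrite exprSr mulmxA => /Dinj.
exists n.+1.
have shift b v k : generalized_eigenvector D b v ->
    generalized_eigenvector D (b + a *+ k) (v *m ad u ^+ k).
  move=> vb; elim: k => [|k IH]; first by rewrite expr0 mulmx1 addr0.
  by rewrite exprSr mulrSr addrA mulmxA; apply: generalized_eigenvector_ad.
suff /vspaceP kerE : lker (linfun (mulmxr (ad u ^+ n.+1))) = fullv :> {vspace 'rV_n}.
  apply/row_matrixP => i; rewrite rowE row0; apply/eqP.
  by have := kerE (delta_mx 0 i); rewrite memvf memv_ker lfunE.
apply: (@generalized_eigenvectors_span _ _ D) => b v vb.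
rewrite memv_ker lfunE /=; apply: contraT => vn.
have vk k : (k <= n)%N -> v *m ad u ^+ k != 0.
  move=> kn; apply: contraNneq vn => vk0.
  by rewrite -(subnKC (leqW kn)) exprD [_ *m (_ *m _)]mulmxA vk0 mul0mx.
(* If [v] survived, these would be [n.+1] roots, distinct in characteristic zero, of a polynomial of
   degree [n]. *)
pose rs := [seq b + a *+ k | k <- iota 0 n.+1].
have rs_root : all (root (char_poly D)) rs.
  apply/allP => _ /mapP[k + ->]; rewrite mem_iota => /= kn.
  exact: generalized_eigenvalue (shift _ _ k vb) (vk _ kn).
have rs_uniq : uniq rs.
  rewrite map_inj_uniq ?iota_uniq // => i j /addrI.
  wlog ij : i j / (i <= j)%N.
    by move=> W; case/orP: (leq_total i j) => [/W //|/W H /esym/H].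
  move/eqP; rewrite eq_sym -subr_eq0 -mulrnBr // -mulr_natr mulf_eq0 (negbTE a0) /=.
  rewrite ((pcharf0P F).1 char0) subn_eq0 => ji.
  by apply/eqP; rewrite eqn_leq ij.
have := max_poly_roots (monic_neq0 (char_poly_monic D)) rs_root rs_uniq.
by rewrite size_char_poly size_map size_iota ltnn.
Qed.

(** The operators [ad u] with [u] a generalized eigenvector are closed under commutators. The
    preimage under [ad] of the resulting [U] contains all such [u], hence is everything. *)
Lemma jacobson_nilpotent : exists (U : {vspace 'M[F]_n}) N,
  (forall u, ad u \in U) /\ forall v, annihilated U N v.
Proof.
have [||U [N [SU annU]]] :=
    @engel_jacobson F n
      (fun s => exists a u, generalized_eigenvector D a u /\ s = ad u).
- move=> _ _ [a [u [ua ->]]] [b [v [vb ->]]]; exists (a + b), (u *m ad v).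
  by split; [exact: generalized_eigenvector_ad|rewrite adP].
- by move=> _ [a [u [ua ->]]]; apply: ad_generalized_eigenvector_nilpotent ua.
exists U, N; split=> // u.
suff /vspaceP/(_ u) : (linfun ad @^-1: U)%VS = fullv.
  by rewrite memvf -memv_preim lfunE.
apply: (@generalized_eigenvectors_span _ _ D) => a v va.
by rewrite -memv_preim lfunE; apply: SU; exists a, v.
Qed.

End NonsingularDerivation.

(** * Jacobson's theorem by extension of scalars *)

Section Jacobson.
Variables (K : fieldType) (C : closedFieldType) (f : {rmorphism K -> C}).
Variables (h : lieAlgType K) (D : {linear h -> h}).
Hypothesis char0 : [pchar C] =i pred0.
Hypothesis Dinj : injective D.
Hypothesis derD : forall x y, D (lie x y) = lie x (D y) + lie (D x) y.

Local Notation n := (dim h).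

Let toC (x : h) : 'rV[C]_n := map_mx f (v2r x).

Let mx_of (g : h -> h) : 'M[C]_n :=
  \matrix_i toC (g (r2v (delta_mx 0 i))).

Lemma toC_mul (g : {linear h -> h}) x : toC x *m mx_of g = toC (g x).
Proof.
rewrite /toC mulmx_sum_row -{2}[x]v2rK [in RHS](row_sum_delta (v2r x)).
rewrite !linear_sum /= raddf_sum; apply: eq_bigr => i _.
by rewrite rowK mxE !linearZ /= map_mxZ.
Qed.

(** The image of [h] contains the standard basis, so it spans the extension over [C]. *)
Lemma toC_ind (P : 'rV[C]_n -> Prop) :
  (forall a u v, P u -> P v -> P (a *: u + v)) -> (forall x, P (toC x)) ->
  forall u, P u.
Proof.
move=> Plin PC u; rewrite (row_sum_delta u).
elim/big_ind: _ => [|v w Pv Pw|i _].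
- by have := PC 0; rewrite /toC linear0 map_mx0.
- by rewrite -[v]scale1r; apply: Plin.
- have P0 : P 0 by have := PC 0; rewrite /toC linear0 map_mx0.
  rewrite -[_ *: _]addr0; apply: Plin => //.
  by have := PC (r2v (delta_mx 0 i)); rewrite /toC r2vK map_delta_mx.
Qed.

Let adC (u : 'rV[C]_n) : 'M[C]_n :=
  \sum_i u 0 i *: mx_of (lie (r2v (delta_mx 0 i))).

Lemma adC_linear : linear adC.
Proof.
move=> a u v; rewrite scaler_sumr -big_split; apply: eq_bigr => i _.
by rewrite !mxE scalerDl scalerA.
Qed.

HB.instance Definition _ :=
  GRing.isLinear.Build C 'rV[C]_n 'M[C]_n _ adC adC_linear.

Lemma adC_toC x : adC (toC x) = mx_of (lie x).
Proof.
apply/row_matrixP => i; rewrite rowK linear_sum /=.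
rewrite -{2}[x]v2rK [in RHS](row_sum_delta (v2r x)) linear_sum /= linear_sumlz.
rewrite /toC linear_sum /= raddf_sum; apply: eq_bigr => j _.
by rewrite linearZ /= rowK !mxE linearZ linearZl_LR linearZ /= map_mxZ.
Qed.

Lemma mx_eq (A B : 'M[C]_n) : (forall y, toC y *m A = toC y *m B) -> A = B.
Proof.
move=> AB; apply/row_matrixP => i; rewrite !rowE.
by have := AB (r2v (delta_mx 0 i)); rewrite /toC r2vK map_delta_mx.
Qed.

Lemma jacobson : lie_nilpotent h.
Proof.
have [|u|u v|U [N [adU annU]]] := @jacobson_nilpotent C n (mx_of D) adC char0.
- move=> u uD.
  have DE : mx_of D = map_mx f (lin1_mx (v2r \o D \o r2v)).
    by apply/row_matrixP => i; rewrite rowK -map_row rowE mul_rV_lin1.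
  (* Matrix rank is unchanged by field extension, so injectivity of [D] passes to [C]. *)
  suff Dfree : row_free (mx_of D).
    by apply: (row_free_inj Dfree); rewrite uD mul0mx.
  rewrite DE row_free_map; apply/inj_row_free => v.
  rewrite mul_rV_lin1 /= => Dv; apply: (can_inj (@r2vK _ _)); apply: Dinj.
  by apply: (can_inj (@v2rK _ _)); rewrite Dv !linear0.
- elim/toC_ind: u => [a u v hu hv|x].
    rewrite !mulmxDl -!scalemxAl !(linearP adC) mulmxDl -scalemxAl hu hv.
    by rewrite mulmxDr -scalemxAr scalerDr addrACA.
  apply: mx_eq => y; rewrite mulmxA mulmxDr mulmxA !toC_mul /= !adC_toC !toC_mul.
  by rewrite derD /toC linearD map_mxD.
- elim/toC_ind: u => [a u u' hu hu'|x].
    rewrite (linearP adC) !mulmxDr !mulmxDl -!scalemxAr -!scalemxAl (linearP adC).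
    by rewrite -hu -hu' /= scalerBr opprD addrACA.
  elim/toC_ind: v => [a v v' hv hv'|z].
    rewrite (linearP adC) !mulmxDl !mulmxDr -!scalemxAl -!scalemxAr (linearP adC).
    by rewrite -hv -hv' /= scalerBr opprD addrACA.
  apply: mx_eq => y; rewrite mulmxBr !mulmxA /= !adC_toC !toC_mul !adC_toC !toC_mul.
  by have /= := ad_lie x z y; rewrite !adE /= => ->; rewrite /toC linearB map_mxB.
(* Each bracket lowers the layer by one, so [lower_central h N] lands in layer [0]. *)
have ann_lower k : (k <= N)%N -> forall y, y \in lower_central h k ->
    annihilated U (N - k) (toC y).
  elim: k => [|k IH] kN y; first by rewrite subn0.
  have toC0 : annihilated U (N - k.+1) (toC 0).
    by rewrite /toC linear0 map_mx0; apply: annihilated0.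
  rewrite /= /lie_prodv; set l := flatten _ => yl.
  have {yl}/coord_span-> : y \in <<in_tuple l>>%VS by [].
  elim/big_rec: _ => // i z _ hz.
  rewrite /toC linearP map_mxD map_mxZ; apply: annihilatedP => //.
  have /allpairsP[[x w] /= [xX wX ->]] : l`_i \in l by apply: mem_nth.
  rewrite -/(toC _) -toC_mul -adC_toC.
  by have := IH (ltnW kN) w (vbasis_mem wX); rewrite -(subnSK kN); apply.
exists N; apply/eqP; rewrite -subv0; apply/subvP => y /(ann_lower N (leqnn _)).
rewrite subnn /= memv0 => y0; apply/eqP/(can_inj (@v2rK _ _)).
apply/rowP => i; rewrite linear0 mxE; apply: (fmorph_inj f).
by rewrite rmorph0; have := congr1 (fun M : 'rV_n => M 0 i) y0; rewrite !mxE.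
Qed.

End Jacobson.

Section SemidirectBracket.
Variables (R : fieldType) (h : lieAlgType R) (V : vectType R) (pi : lieRep h V).

Lemma lie_inl x y :
  lie (semidirect_inl pi x) (semidirect_inl pi y) = semidirect_inl pi (lie x y).
Proof. by congr (_, _); rewrite /= !linear0 addr0. Qed.

Lemma lie_inl_inr x v :
  lie (semidirect_inl pi x) (semidirect_inr pi v) = semidirect_inr pi (pi x v).
Proof.
congr (_, _); first exact: linear0r.
by rewrite /= (linear0 (pi 0)) subr0.
Qed.

Lemma lie_inr_inl x v :
  lie (semidirect_inr pi v) (semidirect_inl pi x) = semidirect_inr pi (- pi x v).
Proof.
congr (_, _); first exact: linear0l.
by rewrite /= (linear0 (pi 0)) sub0r.
Qed.

End SemidirectBracket.

(** * Cotangent Lie algebras *)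

Section Cotangent.
Variables (R : realType) (h : lieAlgType R).
Variable omega : {skew_symmetric (cotangent h)}.
Hypothesis omega_closed : closed_form omega.
Hypothesis fibre_lagrangian : lagrangian omega (fibre_subspace (coad_rep h)).

Local Notation inl := (@semidirect_inl R h _ (coad_rep h)).
Local Notation inr := (@semidirect_inr R h _ (coad_rep h)).

Let dual i : 'Hom(h, R^o) := linfun (coord (vbasis {:h}) i : h -> R^o).

(* [D] is the identification [h -> h^** = h] given by the pairing of [h] with
   [h^*] under [omega]. *)
Let D (x : h) : h := \sum_i omega (inl x) (inr (dual i)) *: (vbasis {:h})`_i.

Lemma dual_sum (phi : 'Hom(h, R^o)) :
  phi = \sum_(i < \dim {:h}) phi (vbasis {:h})`_i *: dual i.
Proof.
apply/lfunP => x; rewrite {1}(coord_vbasis (memvf x)) linear_sum sum_lfunE.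
by apply: eq_bigr => i _; rewrite linearZ scale_lfunE lfunE /= [LHS]mulrC.
Qed.

Lemma pairingE x phi : omega (inl x) (inr phi) = phi (D x).
Proof.
rewrite {1}[phi]dual_sum linear_sum linear_sumr [RHS]linear_sum.
apply: eq_bigr => i _; rewrite linearZ linearZr_LR /= linearZ.
exact: mulrC.
Qed.

Lemma pairing_skew x phi : omega (inr phi) (inl x) = - phi (D x).
Proof. by rewrite hermC expr1 mulN1r /= pairingE. Qed.

Lemma dual_separates (x : h) : (forall phi : 'Hom(h, R^o), phi x = 0) -> x = 0.
Proof.
move=> x0; rewrite (coord_vbasis (memvf x)) big1 // => i _.
by have := x0 (dual i); rewrite lfunE /= => ->; rewrite scale0r.
Qed.

Lemma pairing_map_linear : linear D.
Proof.
move=> a x y; rewrite scaler_sumr -big_split; apply: eq_bigr => i _ /=.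
by rewrite linearP linearDl linearZl_LR /= scalerDl scalerA.
Qed.

HB.instance Definition _ := GRing.isLinear.Build R h h _ D pairing_map_linear.

(** If [D x = 0], then [inl x] is orthogonal to the fibre, hence lies in it, which forces
    [x = 0]. *)
Lemma pairing_map_injective : injective D.
Proof.
apply: raddf_inj => x Dx0.
have : inl x \in fibre_subspace (coad_rep h).
  rewrite -fibre_lagrangian; apply/mem_orthovP => -[y phi].
  rewrite mem_fibre_subspace /= => /eqP ->.
  by rewrite -/(inr phi) pairingE Dx0 linear0.
by rewrite mem_fibre_subspace => /eqP.
Qed.

(** Closedness at [inl x], [inl y], [inr phi] is the identity evaluated under [phi]. *)
Lemma pairing_map_derivation x y : D (lie x y) = lie x (D y) + lie (D x) y.
Proof.
apply/eqP; rewrite -subr_eq0; apply/eqP; apply: dual_separates => phi.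
have := omega_closed (inl x) (inl y) (inr phi).
rewrite lie_inl lie_inl_inr lie_inr_inl pairingE !pairing_skew => E.
rewrite linearB linearD /= -E.
rewrite opp_lfunE !coadE [lie (D x) y]lie_anti linearN /=; ring.
Qed.

Lemma cotangent_nilpotent : lie_nilpotent h.
Proof.
apply: (@jacobson R R[i] (real_complex R) h D)
  pairing_map_injective pairing_map_derivation.
exact: pchar_num.
Qed.

End Cotangent.

(** * Tangent Lie algebras *)

Section Tangent.
Variables (R : realType) (h : lieAlgType R) (B : h -> h -> R).
Hypothesis Blinear : bilinear_for *%R *%R B.
Hypothesis Bleft : forall x, (forall y, B x y = 0) -> x = 0.
Hypothesis Bright : forall y, (forall x, B x y = 0) -> y = 0.
(** Sending [x] to [B x] is a 1-cocycle with values in the coadjoint representation. *)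
Hypothesis Bcocycle : forall x y z,
  B (lie x y) z = B x (lie y z) - B y (lie x z).

Let omega (p q : tangent h) : R := B p.1 q.2 - B q.1 p.2.

Fact omega_bilinear : bilinear_for *%R ( idfun \; *%R ) omega.
Proof.
split=> [q a p p'|p a q q']; rewrite /omega /= Blinear.1 Blinear.2 /=; ring.
Qed.

HB.instance Definition _ :=
  bilinear_isBilinear.Build R (tangent h) (tangent h) R *%R (idfun \; *%R) omega
    omega_bilinear.

Fact omega_skew p q : omega p q = (-1) ^+ true * idfun (omega q p).
Proof. by rewrite /omega expr1 mulN1r opprB. Qed.

HB.instance Definition _ :=
  isHermitianSesquilinear.Build R (tangent h) true idfun omega omega_skew.

(** [Bleft] kills the first component of a vector orthogonal to the fibre, [Bright] the second
    component of one orthogonal to the base. *)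
Lemma tangent_lagrangian :
  exists omega : {skew_symmetric (tangent h)}, lagrangian_symplectic omega.
Proof.
have B0l y : B 0 y = 0.
  by have := Blinear.1 y (-1) 0 0; rewrite scaleN1r addNr /= mulN1r addNr.
have B0r x : B x 0 = 0.
  by have := Blinear.2 x (-1) 0 0; rewrite scaleN1r addNr /= mulN1r addNr.
have BB x y z : B x (y - z) = B x y - B x z.
  have := Blinear.2 x (-1) z y.
  by rewrite /= scaleN1r mulN1r [- z + y]addrC [- B x z + _]addrC.
have omega_inl p x : omega p (semidirect_inl (ad_rep h) x) = - B x p.2.
  by rewrite /omega /= B0r sub0r.
have omega_inr p y : omega p (semidirect_inr (ad_rep h) y) = B p.1 y.
  by rewrite /omega /= B0l subr0.
have left0 (p : tangent h) :
    (forall y, omega p (semidirect_inr (ad_rep h) y) = 0) -> p.1 = 0.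
  by move=> p0; apply: Bleft => y; rewrite -omega_inr.
have right0 (p : tangent h) :
    (forall x, omega p (semidirect_inl (ad_rep h) x) = 0) -> p.2 = 0.
  by move=> p0; apply: Bright => x; apply: oppr_inj; rewrite -omega_inl p0 oppr0.
exists omega; split; first split.
- rewrite /nondegenerate -subv0; apply/subvP => p /mem_orthovP p0.
  rewrite memv0; apply/eqP; rewrite [p]surjective_pairing.
  rewrite left0 ?right0 // => x; apply: p0; exact: memvf.
(* Closedness splits into three cocycle identities, one for each of [p.2], [q.2], [r.2]. *)
- move=> p q r; rewrite /= /omega /= !adE !BB !Bcocycle; ring.
- apply/vspaceP => p; rewrite mem_base_subspace; apply/mem_orthovP/eqP => [p0|p0 q].
    by apply: right0 => x; apply: p0; rewrite mem_base_subspace.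
  by rewrite mem_base_subspace /= /omega => /eqP ->; rewrite p0 !B0r subr0.
- apply/vspaceP => p; rewrite mem_fibre_subspace; apply/mem_orthovP/eqP => [p0|p0 q].
    by apply: left0 => x; apply: p0; rewrite mem_fibre_subspace.
  by rewrite mem_fibre_subspace /= /omega => /eqP ->; rewrite p0 !B0l subr0.
Qed.

End Tangent.

Section Isomorphism.
Variables (R : realType) (g h : lieAlgType R) (B : h -> h -> R).
Hypothesis Blinear : bilinear_for *%R *%R B.
Hypothesis Bleft : forall x, (forall y, B x y = 0) -> x = 0.
Hypothesis Bright : forall y, (forall x, B x y = 0) -> y = 0.
Hypothesis Bcocycle : forall x y z,
  B (lie x y) z = B x (lie y z) - B y (lie x z).

Lemma tangent_lagrangian_isomorphic : lie_isomorphic g h ->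
  exists omega : {skew_symmetric (tangent g)}, lagrangian_symplectic omega.
Proof.
move=> [f [f' fK f'K] fM].
apply: (@tangent_lagrangian R g (fun x y => B (f x) (f y))).
- by split=> [y a x x'|x a y y'] /=; rewrite linearP (Blinear.1, Blinear.2).
- move=> x x0; apply: (can_inj fK); rewrite linear0; apply: Bleft => y.
  by rewrite -[y]f'K.
- move=> y y0; apply: (can_inj fK); rewrite linear0; apply: Bright => x.
  by rewrite -[x]f'K.
- by move=> x y z; rewrite !fM.
Qed.

End Isomorphism.

(** * Explicit cocycles in dimension three *)

Section ThreeDimensional.
Variable R : realType.

Lemma lie3_coord (a b c d : R) (u v : lie3 a b c d) :
  [/\ (lie u v : 'rV[R]_3) 0 0 = 0,
      (lie u v : 'rV[R]_3) 0 1 =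
        (u 0 0 * v 0 1 - u 0 1 * v 0 0) * a + (u 0 0 * v 0 2 - u 0 2 * v 0 0) * c &
      (lie u v : 'rV[R]_3) 0 2 =
        (u 0 0 * v 0 1 - u 0 1 * v 0 0) * b + (u 0 0 * v 0 2 - u 0 2 * v 0 0) * d].
Proof. by split; rewrite !mxE /=; ring. Qed.

Lemma row3P (u v : 'rV[R]_3) :
  u 0 0 = v 0 0 -> u 0 1 = v 0 1 -> u 0 2 = v 0 2 -> u = v.
Proof.
move=> e0 e1 e2; apply/rowP => -[[|[|[|//]]] i3].
- by rewrite (_ : Ordinal i3 = 0) //; apply: val_inj.
- by rewrite (_ : Ordinal i3 = 1) //; apply: val_inj.
- by rewrite (_ : Ordinal i3 = 2) //; apply: val_inj.
Qed.

(* The cocycle is [e1* e1* + e2* /\ e3*]: the area form on [<e2, e3>] is invariant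
   under [ad e1] because its trace vanishes. *)
Lemma tangent_unimodular (a b c d : R) (h : lieAlgType R) : d = - a ->
  lie_isomorphic h (lie3 a b c d) ->
  exists omega : {skew_symmetric (tangent h)}, lagrangian_symplectic omega.
Proof.
move=> ->.
apply: (@tangent_lagrangian_isomorphic R h (lie3 a b c (- a)) (fun u v =>
  u 0 0 * v 0 0 + u 0 1 * v 0 2 - u 0 2 * v 0 1)).
- by split=> [v k u u'|u k v v']; rewrite /= !mxE; ring.
(* The test vectors form the dual basis for the form, so they return the coordinates of [u] one by
   one. *)
- move=> u u0; apply: row3P.
  + by have := u0 (delta_mx 0 0); rewrite !mxE /= => <-; ring.
  + by have := u0 (delta_mx 0 2); rewrite !mxE /= => <-; ring.
  + by have := u0 (- delta_mx 0 1); rewrite !mxE /= => <-; ring.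
- move=> u u0; apply: row3P.
  + by have := u0 (delta_mx 0 0); rewrite !mxE /= => <-; ring.
  + by have := u0 (- delta_mx 0 2); rewrite !mxE /= => <-; ring.
  + by have := u0 (delta_mx 0 1); rewrite !mxE /= => <-; ring.
- move=> u v w.
  have [-> -> ->] := lie3_coord u v; have [-> -> ->] := lie3_coord u w.
  have [-> -> ->] := lie3_coord v w; ring.
Qed.

(* The cocycle is [e1* /\ e2* + e3* e3*]. *)
Lemma tangent_R_aff (h : lieAlgType R) : lie_isomorphic h (R_aff R) ->
  exists omega : {skew_symmetric (tangent h)}, lagrangian_symplectic omega.
Proof.
apply: (@tangent_lagrangian_isomorphic R h (R_aff R) (fun u v =>
  u 0 0 * v 0 1 - u 0 1 * v 0 0 + u 0 2 * v 0 2)).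
- by split=> [v k u u'|u k v v']; rewrite /= !mxE; ring.
- move=> u u0; apply: row3P.
  + by have := u0 (delta_mx 0 1); rewrite !mxE /= => <-; ring.
  + by have := u0 (- delta_mx 0 0); rewrite !mxE /= => <-; ring.
  + by have := u0 (delta_mx 0 2); rewrite !mxE /= => <-; ring.
- move=> u u0; apply: row3P.
  + by have := u0 (- delta_mx 0 1); rewrite !mxE /= => <-; ring.
  + by have := u0 (delta_mx 0 0); rewrite !mxE /= => <-; ring.
  + by have := u0 (delta_mx 0 2); rewrite !mxE /= => <-; ring.
- move=> u v w.
  have [-> -> ->] := lie3_coord u v; have [-> -> ->] := lie3_coord u w.
  have [-> -> ->] := lie3_coord v w; ring.
Qed.

End ThreeDimensional.

Theorem corollary5p8 (R : realType) :
  (forall h : lieAlgType R,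
     (exists omega : {skew_symmetric (cotangent h)},
        lagrangian_symplectic omega) ->
     lie_nilpotent h)
  /\
  (forall h : lieAlgType R,
     lie_isomorphic h (heisenberg3 R) \/ lie_isomorphic h (r3_m1 R) \/
     lie_isomorphic h (r3_0' R) \/ lie_isomorphic h (R_aff R) ->
     exists omega : {skew_symmetric (tangent h)},
       lagrangian_symplectic omega).
Proof.
split=> h.
  move=> [omega [[_ omega_closed] _ fibre]].
  exact: cotangent_nilpotent omega_closed fibre.
(* In the first three algebras [ad e1] has trace zero; in [R_aff] it has trace [1]. *)
case=> [|[|[|]]]; last exact: tangent_R_aff.
- exact: (@tangent_unimodular R 0 1 0 0 h (esym (oppr0 R))).
- exact: (@tangent_unimodular R 1 0 0 (- 1) h erefl).
- exact: (@tangent_unimodular R 0 (- 1) 1 0 h (esym (oppr0 R))).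
Qed.
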